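(* Let $k$ be a nonnegative integer and $0<p<\infty$. (i) If $0<\alpha<\infty$, then the function $r\mapsto\ln\mathsf M_{p,\alpha}(z^k,r)$ is concave in $\ln r$ for $r\in(0,\infty)$. (ii) If $-\infty<\alpha\le0$, then there exists some $c\in(0,\infty)$ such that the function $r\mapsto\ln\mathsf M_{p,\alpha}(z^k,r)$ is convex in $\ln r$ on $(0,c]$ and concave in $\ln r$ on $[c,\infty)$.
   Context: Let $dA$ be the Euclidean area measure on $\mathbb C$. For an entire function $f:\mathbb C\to\mathbb C$, $p\in(0,\infty)$, $\alpha\in\mathbb R$ and $r\in(0,\infty)$, $$\mathsf M_{p,\alpha}(f,r)=\frac{\int_{|z|<r}|f(z)|^pe^{-\alpha|z|^2}\,dA(z)}{\int_{|z|<r}e^{-\alpha|z|^2}\,dA(z)}.$$ $\mathsf M_{p,\alpha}(z^k,r)$ denotes this quantity for $f(z)=z^k$. A function $g$ on an interval $I\subset(0,\infty)$ is convex (respectively concave) in $\ln r$ on $I$ if $t\mapsto g(e^t)$ is convex (respectively concave) on $\{\ln r:r\in I\}$. *)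

(* Defs.v *)
From HB Require Import structures.
From mathcomp Require Import all_boot all_order all_algebra complex.
From mathcomp Require Import all_classical all_reals all_analysis.
Import Order.TTheory GRing.Theory Num.Theory.
Import numFieldNormedType.Exports.

Set Implicit Arguments.
Unset Strict Implicit.
Unset Printing Implicit Defensive.

Local Open Scope classical_set_scope.
Local Open Scope ring_scope.

(* R[i] carries no sigma-algebra in the library, so the plane is integrated over
   as R * R, the pair (x, y) standing for the complex number x + iy. *)
Definition toC (R : realType) (w : R * R) : R[i] := Complex w.1 w.2.

Definition area (R : realType) :=
  (@lebesgue_measure R \x @lebesgue_measure R)%E.

(* `|_| on R[i] takes values in R[i]; Normc.normc is the same modulus in R. *)
Definition modulus (R : realType) (z : R[i]) : R := Normc.normc z.

Definition disk (R : realType) (r : R) : set (R * R) :=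
  [set w | modulus (toC w) < r].

Definition gauss_weight (R : realType) (alpha : R) (w : R * R) : R :=
  expR (- alpha * modulus (toC w) ^+ 2).

(* [Rintegral] sends an infinite integral to 0; for entire f and p > 0 both
   integrands are bounded on the disk, so both integrals are finite. *)
Definition area_mean (R : realType) (p alpha : R) (f : R[i] -> R[i]) (r : R)
    : R :=
  (\int[@area R]_(w in disk r)
      (modulus (f (toC w)) `^ p * gauss_weight alpha w)) /
  (\int[@area R]_(w in disk r) gauss_weight alpha w).

(* Convexity and concavity in ln r, meant for intervals I contained in ]0, +oo[
   (ln is 0 on nonpositive arguments). *)
Definition convex_in_ln (R : realType) (I : set R) (g : R -> R) : Prop :=
  @convex_function R R^o (@ln R @` I) (fun t => g (expR t)).

Definition concave_in_ln (R : realType) (I : set R) (g : R -> R) : Prop :=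
  @convex_function R R^o (@ln R @` I) (fun t => - g (expR t)).

(* Main.v *)
Require Import Defs.
From HB Require Import structures.
From mathcomp Require Import all_boot all_order all_algebra complex.
From mathcomp Require Import all_classical all_reals all_analysis.
From mathcomp Require Import measurable_realfun ring lra.
Import Order.TTheory GRing.Theory Num.Theory.
Import numFieldNormedType.Exports.
Local Open Scope classical_set_scope.
Local Open Scope ring_scope.

(** Put m = k p / 2.  In the variable x = r ^ 2 the area mean of z ^ k is the
    quotient F_m (x) / F_0 (x) of two incomplete gamma integrals,
    F_n (x) = \int_0^x t ^ n e ^ (- alpha t) dt: the image of the area measure
    under z |-> |z| ^ 2 is a constant multiple of Lebesgue measure on the half
    line, because a dilation by r multiplies areas by r ^ 2, and the constant
    cancels in the quotient ([area_mean_igamma]).  With r = e ^ t, the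
    derivative of the logarithm of the mean with respect to t is 2 psi (x),
    where psi = A_m - A_0 and A_n = x F_n' / F_n ([slope_gap]).  Concavity and
    convexity in ln r are therefore the decrease and the increase of psi.

    Each A_n solves x A' = A (n + 1 - alpha x - A), and A_0 is elementary, so
    psi solves a Riccati equation x psi' = - Q (psi, x), where Q is a quadratic
    polynomial in psi whose coefficients involve x and b (y) = y / (e ^ y - 1),
    y = |alpha| x.  Moreover psi >= 0 and psi tends to m at 0.  For positive
    values of psi the sign of Q goes from negative to positive as psi grows,
    so that a level v can be crossed only downwards where Q (v, .) >= 0 and
    only upwards where Q (v, .) <= 0 ([barrier_le], [barrier_ge]).

    If alpha > 0, then Q (v, .) is nondecreasing, and nonnegative when v >= m.
    An increase of psi from below v to above v would force Q (v, .) < 0 to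
    the left, hence v < m; but psi starts at m, above v, and cannot descend
    through v there.  So psi is nonincreasing ([riccati_nonincreasing]).

    If alpha < 0, then psi >= m, and for v > m the function Q (v, .) is convex
    because b is.  Its negative set is an interval, before which psi cannot
    rise above v (it starts at m < v) and after which it cannot return above v;
    hence the superlevel sets of psi are intervals
    ([riccati_quasi_concave]).  As Q (v, x) grows linearly in x, psi also
    falls below any v > m in the long run, so it attains its maximum at some
    point, and increases before it and decreases after it ([riccati_humped]).
    If alpha = 0, then psi is constant. *)

(** * Monotonicity, barriers and convexity from derivatives *)

Section Derivatives.
Context {R : realType}.
Implicit Types (f df : R -> R) (a b v x y z : R).

Lemma is_derive1M {f g : R -> R} {x df dg d : R} :
  is_derive x 1 f df -> is_derive x 1 g dg -> df * g x + f x * dg = d ->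
  is_derive x 1 (fun t => f t * g t) d.
Proof.
move=> fdf gdg <-; have -> : df * g x + f x * dg = f x *: dg + g x *: df.
  by rewrite /GRing.scale/= addrC mulrC [_ * df]mulrC [dg * _]mulrC.
exact: is_deriveM.
Qed.

Lemma is_derive1V {f : R -> R} {x df d : R} : f x != 0 ->
  is_derive x 1 f df -> - df / f x ^+ 2 = d ->
  is_derive x 1 (fun t => (f t)^-1) d.
Proof.
move=> fx0 fdf <-; have -> : - df / f x ^+ 2 = - f x ^- 2 *: df.
  by rewrite /GRing.scale/= mulrC mulrN mulNr.
exact: is_deriveV.
Qed.

Lemma derive_ge0_le f df a b :
  (forall x, a <= x <= b -> is_derive x 1 f (df x)) ->
  (forall x, a < x < b -> 0 <= df x) -> a <= b -> f a <= f b.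
Proof.
move=> fdf df0; rewrite le_eqVlt => /predU1P[->//|ab].
have cf : {within `[a, b], continuous f}.
  by apply: derivable_within_continuous => x; rewrite in_itv/= => /fdf [].
have [|c + eq] := @MVT _ f df _ _ ab _ cf.
  by move=> x; rewrite in_itv/= => /andP[ax xb]; apply: fdf; rewrite !ltW.
rewrite in_itv/= => cab; rewrite -subr_ge0 eq mulr_ge0 ?df0//.
by rewrite subr_ge0 ltW.
Qed.

(** A function cannot climb through a level above which its derivative is
    nonpositive: after the last point where it is at most v, it would have to
    increase while staying above v. *)
Lemma barrier_le {f df v a b} :
  (forall x, a <= x <= b -> is_derive x 1 f (df x)) ->
  (forall x, a <= x <= b -> v < f x -> df x <= 0) ->
  a <= b -> f a <= v -> f b <= v.
Proof.
move=> fdf df0 ab fav; rewrite leNgt; apply/negP => vfb.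
pose S := [set x | a <= x <= b /\ f x <= v].
have Sa : S a by split; rewrite ?lexx.
have supS : has_sup S by split; [exists a|exists b => x [/andP[]]].
have ax0 : a <= sup S by apply: ub_le_sup => //; case: supS.
have x0b : sup S <= b by apply: ge_sup; [exists a|move=> x [/andP[]]].
have fx0 : f (sup S) <= v.
  rewrite leNgt; apply/negP => vf.
  have cf : {for (sup S), continuous f}.
    apply: differentiable_continuous; apply/derivable1_diffP.
    by have [] : is_derive (sup S) 1 f (df (sup S)) by apply: fdf; rewrite ax0.
  have : \forall y \near sup S, v < f y by exact: (cvgr_gt (f (sup S)) cf).
  move=> /nbhs_ballP[e e0 be].
  have [y Sy yS] := sup_adherent e0 supS.
  have yle : y <= sup S by apply: ub_le_sup => //; case: supS.
  have : v < f y.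
    by apply: be; rewrite /ball/= ger0_norm ?subr_ge0//; lra.
  by rewrite ltNge (proj2 Sy).
have x0ltb : sup S < b.
  by rewrite lt_neqAle x0b andbT; apply: contraTneq vfb => <-; rewrite -leNgt.
suff : - f (sup S) <= - f b by rewrite lerN2; move: fx0 vfb; lra.
apply: (@derive_ge0_le (fun x => - f x) (fun x => - df x)) => //.
  move=> x /andP[x1 x2]; apply: is_deriveN; apply: fdf.
  by rewrite x2 (le_trans ax0).
move=> x /andP[x1 x2]; rewrite oppr_ge0.
have xab : a <= x <= b by rewrite (ltW x2) (le_trans ax0)// ltW.
apply: df0 => //; rewrite ltNge; apply/negP => fxv.
by move: x1; rewrite ltNge ub_le_sup//; case: supS.
Qed.

Lemma barrier_ge {f df v a b} :
  (forall x, a <= x <= b -> is_derive x 1 f (df x)) ->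
  (forall x, a <= x <= b -> f x < v -> 0 <= df x) ->
  a <= b -> v <= f a -> v <= f b.
Proof.
move=> fdf df0 ab vfa; rewrite -lerN2.
apply: (@barrier_le (fun x => - f x) (fun x => - df x) (- v) a b) => //.
- by move=> x xab; apply: is_deriveN; exact: fdf.
- by move=> x xab; rewrite ltrN2 oppr_le0; exact: df0.
- by rewrite lerN2.
Qed.

(** The mean value theorem on both sides of z compares the two slopes.  The
    inequality is multiplied out so that it also makes sense for a = b. *)
Lemma chord_le f df a b z :
  (forall x, a <= x <= b -> is_derive x 1 f (df x)) ->
  (forall x y, a <= x -> x <= y -> y <= b -> df x <= df y) ->
  a <= z <= b -> f z * (b - a) <= f a * (b - z) + f b * (z - a).
Proof.
move=> fdf dfle /andP[az zb].
have seg u w : a <= u -> u <= w -> w <= b ->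
    exists2 c, u <= c <= w & f w - f u = df c * (w - u).
  move=> au uw wb.
  have duw x : u <= x <= w -> is_derive x 1 f (df x).
    move=> /andP[ux xw]; apply: fdf.
    by rewrite (le_trans au ux) (le_trans xw wb).
  have [||c + ->] := @MVT_segment _ f df _ _ uw.
  - by move=> x; rewrite in_itv/= => /andP[ux xw]; apply: duw; rewrite !ltW.
  - by apply: derivable_within_continuous => x; rewrite in_itv/= => /duw [].
  by rewrite in_itv/= => ?; exists c.
have [c /andP[ac cz] e1] := seg _ _ (lexx a) az zb.
have [d /andP[zd db] e2] := seg _ _ az zb (lexx b).
have cd : df c <= df d by apply: dfle => //; exact: le_trans zd.
have : 0 <= (df d - df c) * ((b - z) * (z - a)).
  by rewrite !mulr_ge0// subr_ge0.
by nra.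
Qed.

Lemma convex_function_derive_nondecreasing f df (D : set R) :
  is_interval D -> (forall x, D x -> is_derive x 1 f (df x)) ->
  (forall x y, D x -> D y -> x <= y -> df x <= df y) ->
  @convex_function R R^o D f.
Proof.
move=> iD fdf dfle.
have cvx (s x y : R) : 0 <= s <= 1 -> D x -> D y ->
    f (s * x + (1 - s) * y) <= s * f x + (1 - s) * f y.
  move=> /andP[s0 s1]; wlog xy : s x y s0 s1 / x <= y => [wlg Dx Dy|Dx Dy].
    have [|/ltW yx] := leP x y; first by move=> xy; exact: wlg.
    have := wlg (1 - s) y x _ _ yx Dy Dx.
    rewrite subKr [_ * y + _]addrC [_ * f y + _]addrC; apply; lra.
  have [->|/eqP xNy] := x =P y; first by rewrite -!mulrDl subrKC !mul1r.
  have {xNy}xy : x < y by rewrite lt_neqAle xNy.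
  set z := _ * _ + _.
  have zxy : x <= z <= y by rewrite /z; apply/andP; split; nra.
  have := @chord_le f df x y z.
  have -> : y - z = s * (y - x) by rewrite /z; ring.
  have -> : z - x = (1 - s) * (y - x) by rewrite /z; ring.
  rewrite !mulrA -mulrDl ler_pM2r ?subr_gt0//.
  rewrite [f x * _]mulrC [f y * _]mulrC; apply => //.
    by move=> u uxy; apply: fdf; exact: (iD x y).
  move=> u w xu uw wy; apply: dfle => //; apply: (iD x y) => //.
    by rewrite xu (le_trans uw).
  by rewrite wy (le_trans xu).
move=> t x y /[!inE] Dx Dy; rewrite !convRE.
by apply: cvx => //; apply/andP; split.
Qed.

End Derivatives.

(** * The function y / (e ^ y - 1) *)

Section Bernoulli.
Context {R : realType}.
Implicit Types (x y z : R).

(** The exponential generating function of the Bernoulli numbers.  It is the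
    logarithmic derivative y F' / F of F (y) = 1 - e ^ (- y). *)
Definition bern y := y / (expR y - 1).

Lemma expR_sub1_gt0 {y} : 0 < y -> 0 < expR y - 1.
Proof. by move=> y0; rewrite subr_gt0 expR_gt1. Qed.

Definition dbern y := (expR y - 1 - y * expR y) / (expR y - 1) ^+ 2.

Lemma is_derive_bern {y} : 0 < y -> is_derive y 1 bern (dbern y).
Proof.
move=> y0; have e0 := expR_sub1_gt0 y0.
have dV : is_derive y 1 (fun t => (expR t - 1)^-1)
    (- expR y / (expR y - 1) ^+ 2).
  have d1 : is_derive y 1 (fun t => expR t - 1) (expR y).
    by apply: is_derive_eq; rewrite subr0.
  by apply: (is_derive1V _ d1) => //; rewrite gt_eqF.
apply: (is_derive1M _ dV) => /=.
by rewrite /dbern; field; rewrite gt_eqF.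
Qed.

Lemma bern_gt0 {y} : 0 < y -> 0 < bern y.
Proof. by move=> y0; rewrite divr_gt0// expR_sub1_gt0. Qed.

Lemma bern_le1 {y} : 0 < y -> bern y <= 1.
Proof.
move=> y0; rewrite ler_pdivrMr ?expR_sub1_gt0// mul1r lerBrDl.
exact: expR_ge1Dx.
Qed.

Lemma expRN_ge {y} : (1 - y) * expR y <= 1.
Proof.
have := expR_ge1Dx (- y).
by rewrite expRN -[X in _ <= X]mul1r ler_pdivlMr ?expR_gt0.
Qed.

Lemma bern_nonincreasing x y : 0 < x -> x <= y -> bern y <= bern x.
Proof.
move=> x0 xy; rewrite -lerN2.
apply: (@derive_ge0_le _ (fun t => - bern t) (fun t => - dbern t) _ _ _ _ xy).
  by move=> t /andP[xt _]; apply: is_deriveN; exact/is_derive_bern/lt_le_trans/xt.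
move=> t /andP[xt _]; rewrite oppr_ge0 /dbern.
rewrite mulr_le0_ge0 ?invr_ge0 ?sqr_ge0//.
by have := @expRN_ge t; lra.
Qed.

(* The numerator of the derivative of y + 2 * bern y. *)
Let two_mul_expR_le y : 0 <= y -> 0 <= expR y ^+ 2 - 1 - 2 * y * expR y.
Proof.
move=> y0.
pose f (t : R) := expR t ^+ 2 - 1 - 2 * t * expR t.
suff : f 0 <= f y by rewrite /f expR0; lra.
apply: (@derive_ge0_le _ f (fun t => 2 * expR t * (expR t - 1 - t))) => //.
  move=> t _; apply: is_derive_eq; rewrite /GRing.scale/=.
  ring.
move=> t _; rewrite mulr_ge0 ?mulr_ge0 ?expR_ge0//.
by have := expR_ge1Dx t; lra.
Qed.

(** The function y + 2 bern y is y coth (y / 2), which is even and equal to 2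
    at 0; it governs the linear coefficient of the Riccati equation. *)
Lemma addr_2bern_nondecreasing x y : 0 < x -> x <= y ->
  x + 2 * bern x <= y + 2 * bern y.
Proof.
move=> x0 xy.
apply: (@derive_ge0_le _ (fun t => t + 2 * bern t) (fun t => 1 + 2 * dbern t)
  _ _ _ _ xy).
  move=> t /andP[xt _]; have dt := is_derive_bern (lt_le_trans x0 xt).
  by apply: is_deriveD; exact: is_deriveZ.
move=> t /andP[xt _]; have t0 : 0 < t by exact: lt_trans xt.
have e0 := expR_sub1_gt0 t0.
have -> : 1 + 2 * dbern t = (expR t ^+ 2 - 1 - 2 * t * expR t) / (expR t - 1) ^+ 2.
  by rewrite /dbern; field; rewrite gt_eqF.
by rewrite divr_ge0 ?sqr_ge0// two_mul_expR_le// ltW.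
Qed.

(* This expression is, up to a positive factor, both the second derivative of
   bern and the difference y + 2 * bern y - 2. *)
Let bern_second_ge0 y : 0 <= y -> 0 <= (y - 2) * expR y + y + 2.
Proof.
move=> y0.
pose f (t : R) := (t - 2) * expR t + t + 2.
suff : f 0 <= f y by rewrite /f expR0; lra.
apply: (@derive_ge0_le _ f (fun t => (t - 1) * expR t + 1)) => //.
  by move=> t _; apply: is_derive_eq; rewrite /GRing.scale/=; ring.
by move=> t _; have := @expRN_ge t; lra.
Qed.

Lemma addr_2bern_ge2 y : 0 < y -> 2 <= y + 2 * bern y.
Proof.
move=> y0; have e0 := expR_sub1_gt0 y0.
suff : 0 <= (y + 2 * bern y - 2) * (expR y - 1) by rewrite pmulr_lge0//; lra.
have -> : (y + 2 * bern y - 2) * (expR y - 1) = (y - 2) * expR y + y + 2.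
  by rewrite /bern; field; rewrite gt_eqF.
by rewrite bern_second_ge0// ltW.
Qed.

(** The second derivative of bern is nonnegative. *)
Lemma bern_chord x y z : 0 < x -> x <= z <= y ->
  bern z * (y - x) <= bern x * (y - z) + bern y * (z - x).
Proof.
move=> x0; apply: (@chord_le _ bern dbern).
  by move=> t /andP[xt _]; exact/is_derive_bern/lt_le_trans/xt.
move=> s t xs st _.
pose d2 (t : R) := expR t * ((t - 2) * expR t + t + 2) / (expR t - 1) ^+ 3.
apply: (@derive_ge0_le _ dbern d2 _ _ _ _ st); last first.
  move=> u /andP[su _]; have u0 : 0 < u by rewrite (lt_trans _ su)// (lt_le_trans x0).
  rewrite /d2 divr_ge0 ?exprn_ge0 ?(ltW (expR_sub1_gt0 u0))//.
  by rewrite mulr_ge0 ?expR_ge0// bern_second_ge0// ltW.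
move=> u /andP[su _]; have u0 : 0 < u by rewrite (lt_le_trans _ su)// (lt_le_trans x0).
have e0 := expR_sub1_gt0 u0.
have d1 : is_derive u 1 (fun t => (expR t - 1) ^+ 2)
    (2 * (expR u - 1) * expR u).
  by apply: is_derive_eq; rewrite /GRing.scale/=; ring.
have d2' : is_derive u 1 (fun t => expR t - 1 - t * expR t) (- (u * expR u)).
  by apply: is_derive_eq; rewrite /GRing.scale/=; ring.
apply: (is_derive1M d2' (is_derive1V _ d1 erefl)) => /=.
  by rewrite expf_neq0// gt_eqF.
by rewrite /d2; field; rewrite gt_eqF.
Qed.

End Bernoulli.

(** * Monotonicity of the solutions of a Riccati equation *)

Section Riccati.
Context {R : realType} (m c : R).
Hypothesis (m0 : 0 <= m) (c0 : 0 <= c).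
Implicit Types (a b e s t v w x y z : R).

(** The right-hand side of the Riccati equation x psi' = - ricc (psi x) y with
    y = |alpha| x.  The parameter c is 0 for alpha > 0 and m for alpha < 0: the
    logarithmic slope of F_0 is bern y in the first case and y + bern y in the
    second. *)
Definition ricc v y := v ^+ 2 - v * (m + 1) + (v - c) * y + (2 * v - m) * bern y.

(* The quotient ricc v y / v is increasing in v > 0, since ricc 0 y <= 0; this
   cross-multiplied form yields the two sign transfers below. *)
Let ricc_cross v w y : v * ricc w y - w * ricc v y =
  (w - v) * (v * w + c * y + m * bern y).
Proof. by rewrite /ricc; ring. Qed.

Let ricc_cross_ge0 v w y : 0 <= v -> v <= w -> 0 < y -> w * ricc v y <= v * ricc w y.
Proof.
move=> v0 vw y0; rewrite -subr_ge0 ricc_cross.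
have b0 := bern_gt0 y0; have w0 : 0 <= w by exact: le_trans vw.
by rewrite mulr_ge0 ?subr_ge0// !addr_ge0//; apply: mulr_ge0 => //; exact: ltW.
Qed.

Lemma ricc_ge0_up {v w y} : 0 < v -> v <= w -> 0 < y ->
  0 <= ricc v y -> 0 <= ricc w y.
Proof.
move=> v0 vw y0 r0; rewrite -(pmulr_rge0 _ v0).
apply: (le_trans _ (ricc_cross_ge0 v w y (ltW v0) vw y0)).
by rewrite mulr_ge0// (le_trans (ltW v0)).
Qed.

Lemma ricc_le0_down {v w y} : 0 <= v -> v <= w -> 0 < w -> 0 < y ->
  ricc w y <= 0 -> ricc v y <= 0.
Proof.
move=> v0 vw w0 y0 r0; rewrite -(pmulr_rle0 _ w0).
apply: (le_trans (ricc_cross_ge0 v w y v0 vw y0)).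
by rewrite mulr_ge0_le0.
Qed.

Variables (psi : R -> R) (beta : R).
Hypothesis beta0 : 0 < beta.
Hypothesis dpsi : forall x, 0 < x ->
  is_derive x 1 psi (- ricc (psi x) (beta * x) / x).
Hypothesis psi0 : forall x, 0 < x -> 0 <= psi x.
Hypothesis psi_cvg : psi x @[x --> 0^'+] --> m.

Let near0_gt w x : w < m -> 0 < x -> exists e, [/\ 0 < e, e <= x & w <= psi e].
Proof.
move=> wm x0; near (0 : R)^'+ => e; exists e; split => //.
- by near: e; exact: nbhs_right_le.
- by apply/ltW; near: e; exact: (cvgr_gt m psi_cvg).
Unshelve. all: end_near. Qed.

Let near0_lt v : m < v -> exists2 e, 0 < e & forall x, 0 < x < e -> psi x <= v.
Proof.
move=> mv.
have : \forall x \near 0^'+, psi x < v by exact: (cvgr_lt m psi_cvg).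
move=> [e /= e0 be]; exists e => // x /andP[x0 xe].
by apply/ltW/be => //=; rewrite sub0r normrN gtr0_norm.
Qed.

(* Levels are crossed downwards where ricc v >= 0, and upwards where
   ricc w <= 0. *)
Let stays_below v a b : 0 < v -> 0 < a -> a <= b ->
  (forall x, a <= x <= b -> 0 <= ricc v (beta * x)) -> psi a <= v -> psi b <= v.
Proof.
move=> v0 a0 ab rv; apply: (barrier_le _ _ ab) => x /[dup] xab /andP[ax _].
  exact/dpsi/lt_le_trans/ax.
move=> vx; have x0 := lt_le_trans a0 ax.
rewrite mulNr oppr_le0 divr_ge0 ?(ltW x0)//.
by apply: (ricc_ge0_up v0 (ltW vx)); [rewrite mulr_gt0|exact: rv].
Qed.

Let stays_above w a b : 0 < w -> 0 < a -> a <= b ->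
  (forall x, a <= x <= b -> ricc w (beta * x) <= 0) -> w <= psi a -> w <= psi b.
Proof.
move=> w0 a0 ab rv; apply: (barrier_ge _ _ ab) => x /[dup] xab /andP[ax _].
  exact/dpsi/lt_le_trans/ax.
move=> vx; have x0 := lt_le_trans a0 ax.
rewrite divr_ge0 ?(ltW x0)// oppr_ge0.
apply: (ricc_le0_down _ (ltW vx)) => //; [exact: psi0|by rewrite mulr_gt0|exact: rv].
Qed.

Section attractive.
Hypothesis cE : c = 0.

Let ricc_nondecreasing v x y : 0 <= v -> 0 < x -> x <= y ->
  ricc v x <= ricc v y.
Proof.
move=> v0 x0 xy; rewrite -subr_ge0; have -> : ricc v y - ricc v x =
    v * (y + 2 * bern y - (x + 2 * bern x)) + m * (bern x - bern y).
  by rewrite /ricc cE; ring.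
by rewrite addr_ge0// mulr_ge0// subr_ge0;
  [exact: addr_2bern_nondecreasing|exact: bern_nonincreasing].
Qed.

Let ricc_ge0 v y : m <= v -> 0 < y -> 0 <= ricc v y.
Proof.
move=> mv y0; have -> : ricc v y = (v - m) * (v + 1) + v * (y + 2 * bern y - 2) +
    m * (1 - bern y).
  by rewrite /ricc cE; ring.
have v0 : 0 <= v by exact: le_trans mv.
have h1 := addr_2bern_ge2 _ y0; have h2 := bern_le1 y0.
by rewrite !addr_ge0// mulr_ge0 ?subr_ge0// addr_ge0.
Qed.

(** If psi rose from below v to above v, then ricc v would be negative up to
    the starting point, hence v < m.  Since psi is close to m near 0, it would
    have come down through levels below v where only upward crossings are
    possible. *)
Lemma riccati_nonincreasing x y : 0 < x -> x <= y -> psi y <= psi x.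
Proof.
move=> x0 xy; rewrite leNgt; apply/negP => xpy.
pose v := (psi x + psi y) / 2.
have px0 := psi0 x x0.
have v0 : 0 < v by rewrite /v; lra.
have [rv|rv] := leP 0 (ricc v (beta * x)).
  have : psi y <= v; last by rewrite /v; lra.
  apply: (stays_below v x y) => //; last by rewrite /v; lra.
  move=> t /andP[xt _]; apply: (le_trans rv).
  by apply: ricc_nondecreasing; rewrite ?mulr_gt0 ?ler_pM2l// ltW.
have vm : v < m.
  by rewrite ltNge; apply/negP => /ricc_ge0/(_ (mulr_gt0 beta0 x0)); rewrite leNgt rv.
pose w := (psi x + v) / 2.
have w0 : 0 < w by rewrite /w; lra.
have wv : w < v by rewrite /w /v; lra.
have [e [e0 ex we]] := near0_gt w x (lt_trans wv vm) x0.
have : w <= psi x; last by rewrite /w /v; lra.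
apply: (stays_above w e x) => // t /andP[et tx].
have t0 : 0 < t by exact: lt_le_trans et.
apply: (ricc_le0_down (ltW w0) (ltW wv)) => //; first by rewrite mulr_gt0.
apply: le_trans (ltW rv).
by apply: ricc_nondecreasing; rewrite ?mulr_gt0 ?ler_pM2l// ltW.
Qed.

End attractive.

Section humped.
Hypothesis cE : c = m.

Let ricc_le0 w y : 0 <= w -> w <= m -> 0 < y -> ricc w y <= 0.
Proof.
move=> w0 wm y0.
have m_le0 : ricc m y <= 0.
  have -> : ricc m y = m * (bern y - 1) by rewrite /ricc cE; ring.
  by rewrite mulr_ge0_le0// subr_le0 bern_le1.
move: w0; rewrite le_eqVlt => /predU1P[<-|w0].
  have -> : ricc 0 y = - (m * (y + bern y)) by rewrite /ricc cE; ring.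
  have b0 := bern_gt0 y0.
  by rewrite oppr_le0 mulr_ge0// addr_ge0// ltW.
by apply: (ricc_le0_down (ltW w0) wm) => //; exact: lt_le_trans wm.
Qed.

(** Levels below m are crossed only upwards, and psi starts at m. *)
Lemma riccati_ge_m x : 0 < x -> m <= psi x.
Proof.
move=> x0; rewrite leNgt; apply/negP => pxm.
have px0 := psi0 x x0.
pose w := (psi x + m) / 2.
have w0 : 0 < w by rewrite /w; lra.
have wm : w < m by rewrite /w; lra.
have [e [e0 ex we]] := near0_gt w x wm x0.
have : w <= psi x; last by rewrite /w; lra.
apply: (stays_above w e x) => // t /andP[et tx].
by apply: ricc_le0; rewrite ?ltW// mulr_gt0// (lt_le_trans e0).
Qed.

(* For v >= m the function ricc v is convex, being affine plus a nonnegative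
   multiple of bern. *)
Let ricc_lt0_between v a b z : m <= v -> 0 < a -> a < z -> z < b ->
  ricc v a < 0 -> ricc v b < 0 -> ricc v z < 0.
Proof.
move=> mv a0 az zb ra rb.
have vm0 : 0 <= 2 * v - m by move: m0 mv => *; lra.
have zab : a <= z <= b by rewrite !ltW.
have := bern_chord _ _ _ a0 zab => bz.
rewrite -(pmulr_llt0 _ (_ : 0 < b - a)); last by rewrite subr_gt0 (lt_trans az).
have : ricc v z * (b - a) <= ricc v a * (b - z) + ricc v b * (z - a).
  rewrite -subr_ge0.
  have -> : ricc v a * (b - z) + ricc v b * (z - a) - ricc v z * (b - a) =
    (2 * v - m) * (bern a * (b - z) + bern b * (z - a) - bern z * (b - a)).
    by rewrite /ricc; ring.
  apply: mulr_ge0; last by rewrite subr_ge0.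
  exact: vm0.
move/le_lt_trans; apply.
have : ricc v a * (b - z) < 0 by rewrite nmulr_rlt0// subr_gt0.
have : ricc v b * (z - a) < 0 by rewrite nmulr_rlt0// subr_gt0.
lra.
Qed.

(** At a level v with psi z < v < min (psi s) (psi t), the set where ricc v < 0
    is an interval.  If it contains [s, z], then psi cannot come down to psi z.
    Otherwise ricc v is nonnegative at some a in [s, z], so the interval lies on
    one side of a: either psi could not have risen from m to psi s, or it
    cannot rise from psi z to psi t. *)
Lemma riccati_quasi_concave s z t : 0 < s -> s <= z -> z <= t ->
  Num.min (psi s) (psi t) <= psi z.
Proof.
move=> s0 sz zt; rewrite leNgt; apply/negP; rewrite lt_min => /andP[zs zt'].
have [v [zv vs vt]] : exists v, [/\ psi z < v, v < psi s & v < psi t].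
  have : psi z < Num.min (psi s) (psi t) by rewrite lt_min zs.
  move=> zm; exists ((psi z + Num.min (psi s) (psi t)) / 2).
  have h1 : Num.min (psi s) (psi t) <= psi s by rewrite ge_min lexx.
  have h2 : Num.min (psi s) (psi t) <= psi t by rewrite ge_min lexx orbT.
  by move: (Num.min _ _) zm h1 h2 => M zm h1 h2; split; lra.
have z0 : 0 < z by exact: lt_le_trans sz.
have mv : m < v by apply: le_lt_trans zv; exact: riccati_ge_m.
have v0 : 0 < v by exact: le_lt_trans mv.
have [neg|/existsNP[a /not_implyP[/andP[sa az] /negP]]] :=
    pselect (forall a, s <= a <= z -> ricc v (beta * a) < 0).
  have : v <= psi z; last by rewrite leNgt zv.
  apply: (stays_above v s z) => //; last exact: ltW.
  by move=> x sxz; apply/ltW/neg.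
rewrite -leNgt => ra.
have a0 : 0 < a by exact: lt_le_trans sa.
have [left|/existsNP[x /not_implyP[/andP[x0 xa] /negP]]] :=
    pselect (forall x, 0 < x <= a -> 0 <= ricc v (beta * x)).
  have [e e0 pe] := near0_lt v mv.
  have : psi s <= v; last by rewrite leNgt vs.
  pose e' := Num.min s (e / 2).
  have e'0 : 0 < e' by rewrite lt_min s0 divr_gt0.
  have e's : e' <= s by rewrite /e' ge_min lexx.
  apply: (stays_below v e' s) => //; last first.
    apply: pe; rewrite e'0/= /e' gt_min; apply/orP; right; lra.
  move=> x /andP[ex xs]; apply: left.
  by rewrite (lt_le_trans e'0 ex) (le_trans xs).
rewrite -ltNge => rx.
have : psi t <= v; last by rewrite leNgt vt.
apply: (stays_below v z t) => //; last exact: ltW.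
move=> y /andP[zy _]; rewrite leNgt; apply/negP => ry.
have xa' : x < a.
  by rewrite lt_neqAle xa andbT; apply: contraTneq rx => ->; rewrite -leNgt.
have ay : a < y.
  rewrite lt_neqAle (le_trans az zy) andbT.
  by apply: contraTneq ry => <-; rewrite -leNgt.
have : ricc v (beta * a) < 0; last by rewrite ltNge ra.
by apply: (ricc_lt0_between _ (beta * x) (beta * y));
  rewrite ?ltW// ?mulr_gt0// ?ltr_pM2l//.
Qed.

(* Carries the growth of ricc at the level v over to the values of psi above
   v, which gives the rate of descent below. *)
Let ricc_nondecreasing_v v w y : m <= v -> v <= w -> 0 < y -> ricc v y <= ricc w y.
Proof.
move=> mv vw y0; rewrite -subr_ge0.
have -> : ricc w y - ricc v y = (w - v) * (w + v - (m + 1) + (y + 2 * bern y)).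
  by rewrite /ricc; ring.
have := addr_2bern_ge2 _ y0 => h.
have m0' := m0; have wvm : 0 <= w + v - (m + 1) + (y + 2 * bern y) by lra.
by apply: mulr_ge0 => //; rewrite subr_ge0.
Qed.

(** The value of ricc v grows linearly in x when v > m, so psi decreases at a
    rate bounded away from 0 as long as it stays above v. *)
Lemma riccati_eventually_le v : m < v ->
  exists2 T, 0 < T & forall x, T <= x -> psi x <= v.
Proof.
move=> mv.
pose d := (v - m) * beta / 2.
have d0 : 0 < d by rewrite /d divr_gt0// mulr_gt0// subr_gt0.
have m0' := m0; have v0 : 0 < v by exact: le_lt_trans mv.
(* From X on, half of the linear growth of ricc v absorbs v * (m + 1). *)
pose X := v * (m + 1) / d + 1.
have X0 : 0 < X.
  rewrite /X ltr_pwDr// divr_ge0 ?(ltW d0)//.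
  by apply: mulr_ge0; [exact: ltW|exact: addr_ge0].
have slope x : X <= x -> d * x <= ricc v (beta * x).
  move=> Xx; have x0 := lt_le_trans X0 Xx.
  have b0 := bern_gt0 (mulr_gt0 beta0 x0).
  have : v * (m + 1) <= d * x.
    by rewrite -ler_pdivrMl// mulrC; move: Xx; rewrite /X; lra.
  have vm0 : 0 <= 2 * v - m by lra.
  have bv0 : 0 <= (2 * v - m) * bern (beta * x).
    by apply: mulr_ge0 => //; exact: ltW.
  have -> : ricc v (beta * x) = v ^+ 2 - v * (m + 1) + 2 * (d * x) +
      (2 * v - m) * bern (beta * x).
    by rewrite /ricc cE /d; field.
  have := sqr_ge0 v; lra.
have [T XT pT] : exists2 T, X <= T & psi T <= v.
  apply: contrapT => noT.
  have above x : X <= x -> v < psi x.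
    by move=> Xx; rewrite ltNge; apply/negP => pxv; apply: noT; exists x.
  (* A descent at rate d from psi X reaches the level v at Y. *)
  pose Y := X + (psi X - v) / d.
  have pX := above X (lexx _).
  have XY : X <= Y by rewrite /Y lerDl divr_ge0 ?subr_ge0 ?(ltW pX) ?(ltW d0).
  have : - (psi X + d * X) <= - (psi Y + d * Y).
    apply: (@derive_ge0_le _ (fun x => - (psi x + d * x))
      (fun x => - (- ricc (psi x) (beta * x) / x + d))) => //.
      move=> x /andP[Xx _]; apply: is_deriveN.
      have dp := dpsi x (lt_le_trans X0 Xx).
      by apply: is_derive_eq; rewrite /GRing.scale/= mulr1.
    move=> x /andP[Xx _]; have x0 := lt_trans X0 Xx.
    rewrite opprD mulNr opprK subr_ge0 ler_pdivlMr//.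
    apply: (le_trans (slope x (ltW Xx))).
    by apply: ricc_nondecreasing_v; rewrite ?mulr_gt0// ltW// above// ltW.
  rewrite lerN2; apply/negP; rewrite -ltNge.
  have -> : psi X + d * X = v + d * Y by rewrite /Y; field; rewrite gt_eqF.
  by rewrite ltrD2r above.
have T0 := lt_le_trans X0 XT.
exists T => // x Tx; apply: (stays_below v T x) => // y /andP[Ty _].
apply: le_trans (slope y (le_trans XT Ty)).
by rewrite mulr_ge0 ?(ltW d0)// (le_trans (ltW T0)).
Qed.

(** A quasi-concave function that exceeds its limit at 0 and eventually stays
    below an intermediate level attains a maximum, and is monotone on each side
    of it. *)
Lemma riccati_humped : exists a, [/\ 0 < a,
  (forall x y, 0 < x -> x <= y -> y <= a -> psi x <= psi y) &
  (forall x y, a <= x -> x <= y -> psi y <= psi x)].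
Proof.
have [flat|/existsNP[x0 /not_implyP[x00 /negP]]] :=
    pselect (forall x, 0 < x -> psi x <= m).
  have pE x : 0 < x -> psi x = m.
    by move=> x0; apply/eqP; rewrite eq_le flat//= riccati_ge_m.
  exists 1; split => // x y x0 xy.
    by move=> _; rewrite !pE// (lt_le_trans x0).
  by rewrite !pE// ?(lt_le_trans _ x0)// (lt_le_trans _ (le_trans x0 xy)).
rewrite -ltNge => mx0.
pose v := (m + psi x0) / 2.
have mv : m < v by rewrite /v; lra.
have vx0 : v < psi x0 by rewrite /v; lra.
have [e e0 pe] := near0_lt v mv.
have [T T0 pT] := riccati_eventually_le v mv.
have ex0 : e <= x0.
  by rewrite leNgt; apply/negP => xe; move: vx0; rewrite ltNge pe// x00.
have x0T : x0 <= T.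
  by rewrite leNgt; apply/negP => /ltW/pT; rewrite leNgt vx0.
have [|a] := @EVT_max R psi e T (le_trans ex0 x0T).
  apply: derivable_within_continuous => x; rewrite in_itv/= => /andP[ex _].
  by have [] := dpsi x (lt_le_trans e0 ex).
rewrite in_itv/= => /andP[ea aT] amax.
have a0 : 0 < a by exact: lt_le_trans ea.
have vpa : v < psi a by apply: (lt_le_trans vx0); apply: amax; rewrite in_itv/= ex0.
have pa x : 0 < x -> psi x <= psi a.
  move=> x1; have [xe|ex] := ltP x e.
    by rewrite ltW// (le_lt_trans _ vpa)// pe// x1.
  have [Tx|xT] := leP T x; first by rewrite ltW// (le_lt_trans _ vpa)// pT.
  by apply: amax; rewrite in_itv/= ex ltW.
exists a; split => // x y.
  move=> x1 xy ya; have := riccati_quasi_concave x y a x1 xy ya.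
  by rewrite min_l// pa.
move=> ax xy; have := riccati_quasi_concave a x y a0 ax xy.
by rewrite min_r// pa// (lt_le_trans a0)// (le_trans ax).
Qed.

End humped.
End Riccati.

(** * Incomplete gamma integrals and their logarithmic slopes *)

Section AtZero.
Context {R : realType}.
Implicit Types (f g df : R -> R) (t x : R).

(** A negative value f x would lie below the values of f near 0, against the
    monotonicity of f on ]0, x]. *)
Lemma ge0_of_cvg0_derive_ge0 {f df x} :
  (forall t, 0 < t -> t <= x -> is_derive t 1 f (df t)) ->
  (forall t, 0 < t -> t <= x -> 0 <= df t) ->
  f t @[t --> 0^'+] --> 0 -> 0 < x -> 0 <= f x.
Proof.
move=> fdf df0 f0 x0; rewrite leNgt; apply/negP => fx0.
near (0 : R)^'+ => e.
have e0 : 0 < e by [].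
have ex : e <= x by near: e; exact: nbhs_right_le.
have : f x < f e by near: e; exact: (cvgr_gt 0 f0).
apply/negP; rewrite -leNgt; apply: (derive_ge0_le f df) => //.
  by move=> t /andP[et tx]; apply: fdf => //; exact: lt_le_trans et.
by move=> t /andP[et tx]; apply: df0; rewrite ?(ltW tx)// (lt_trans e0).
Unshelve. all: end_near. Qed.

Lemma eq_of_cvg0_derive_eq {f g df x} :
  (forall t, 0 < t -> is_derive t 1 f (df t)) ->
  (forall t, 0 < t -> is_derive t 1 g (df t)) ->
  f t @[t --> 0^'+] --> 0 -> g t @[t --> 0^'+] --> 0 -> 0 < x -> f x = g x.
Proof.
move=> fdf gdf f0 g0 x0.
have half f1 f2 : (forall t, 0 < t -> is_derive t 1 f1 (df t)) ->
  (forall t, 0 < t -> is_derive t 1 f2 (df t)) ->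
  f1 t @[t --> 0^'+] --> 0 -> f2 t @[t --> 0^'+] --> 0 -> f2 x <= f1 x.
  move=> d1 d2 l1 l2; rewrite -subr_ge0.
  apply: (@ge0_of_cvg0_derive_ge0 (fun t => f1 t - f2 t) (fun=> 0)) => //.
    move=> t t0 _; rewrite -(subrr (df t)).
    by apply: is_deriveB; [exact: d1|exact: d2].
  by rewrite -[X in _ --> X](subrr 0); exact: cvgB.
by apply/eqP; rewrite eq_le !half.
Qed.

End AtZero.

Section IncompleteGamma.
Context {R : realType}.
Variables (m alpha : R).
Hypothesis m_ge0 : 0 <= m.
Implicit Types (t x : R).
Notation mu := (@lebesgue_measure R).

Definition gamma_density t := t `^ m * expR (- alpha * t).

Definition igamma x := \int[mu]_(t in `[0, x]) gamma_density t.

Lemma gamma_density_gt0 x : 0 < x -> 0 < gamma_density x.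
Proof. by move=> x0; rewrite mulr_gt0 ?powR_gt0 ?expR_gt0. Qed.

Lemma is_derive_gamma_density x : 0 < x ->
  is_derive x 1 gamma_density ((m / x - alpha) * gamma_density x).
Proof.
move=> x0.
have dp := is_derive1_powR m x0.
have de : is_derive x 1 (fun t => expR (- alpha * t)) (- alpha * expR (- alpha * x)).
  apply: is_derive_eq; rewrite /GRing.scale/=. ring.
apply: (is_derive1M dp de).
have -> : x `^ (m - 1) = x `^ m / x.
  by rewrite powRB ?powRr1 ?(ltW x0)//; apply/implyP => _; rewrite gt_eqF.
by rewrite /gamma_density; field; rewrite gt_eqF.
Qed.

Lemma measurable_gamma_density : measurable_fun setT gamma_density.
Proof.
apply: measurable_funM; first exact: measurable_powR.
apply: measurableT_comp => //.
Qed.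

Lemma integrable_gamma_density x : mu.-integrable `[0, x] (EFin \o gamma_density).
Proof.
apply: measurable_bounded_integrable => //.
- rewrite /= lebesgue_measure_itv/=; case: ifP => _; last exact: ltry.
  by rewrite -EFinD ltry.
- exact: measurable_funTS measurable_gamma_density.
- exists (x `^ m * expR (`|alpha| * x)); split; first exact: num_real.
  move=> M /ltW xM t /=; rewrite in_itv/= => /andP[t0 tx].
  apply: le_trans xM; rewrite normrM ger0_norm ?powR_ge0// ger0_norm ?expR_ge0//.
  apply: ler_pM; rewrite ?powR_ge0 ?expR_ge0//.
    by apply: ge0_ler_powR; rewrite ?nnegrE// (le_trans t0).
  rewrite ler_expR; apply: le_trans (ler_norm _) _.
  by rewrite normrM normrN (ger0_norm t0) ler_wpM2l.
Qed.

Lemma is_derive_igamma x : 0 < x -> is_derive x 1 igamma (gamma_density x).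
Proof.
move=> x0.
have cf : {for x, continuous gamma_density}.
  apply: differentiable_continuous; apply/derivable1_diffP.
  by have [] := is_derive_gamma_density x x0.
have [|d e] := @continuous_FTC1_closed R gamma_density 0 x (x + 1) _
  (integrable_gamma_density _) x0 cf; first by rewrite ltrDl.
by rewrite -e derive1E; exact: derivableP.
Qed.

Lemma igamma_cvg0 : igamma x @[x --> 0^'+] --> 0.
Proof.
apply: cvg_at_right_filter.
by apply: (@parameterized_integral_cvg_left _ 0 1) => //; exact: integrable_gamma_density.
Qed.

Lemma igamma_gt0 x : 0 < x -> 0 < igamma x.
Proof.
move=> x0.
have ge0 t : 0 < t -> 0 <= igamma t.
  apply: (ge0_of_cvg0_derive_ge0 (df := gamma_density) _ _ igamma_cvg0).
    by move=> s s0 _; exact: is_derive_igamma.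
  by move=> s s0 _; rewrite ltW// gamma_density_gt0.
have x20 : 0 < x / 2 by rewrite divr_gt0.
have x2x : x / 2 < x by lra.
apply: le_lt_trans (ge0 _ x20) _; rewrite -subr_gt0.
have [||c + ->] := @MVT _ igamma gamma_density _ _ x2x.
- move=> t; rewrite in_itv/= => /andP[tx _]; apply: is_derive_igamma.
  exact: lt_trans tx.
- apply: derivable_within_continuous => t; rewrite in_itv/= => /andP[tx _].
  by have [] := is_derive_igamma t (lt_le_trans x20 tx).
rewrite in_itv/= => /andP[xc _]; rewrite mulr_gt0 ?subr_gt0//.
by apply: gamma_density_gt0; exact: lt_trans xc.
Qed.

(** The logarithmic derivative x F' / F of the incomplete gamma integral. *)
Definition igamma_slope x := x * gamma_density x / igamma x.

Let is_derive_xdensity x : 0 < x ->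
  is_derive x 1 (fun t => t * gamma_density t) ((m + 1 - alpha * x) * gamma_density x).
Proof.
move=> x0; apply: (is_derive1M (is_derive_id x 1) (is_derive_gamma_density x x0)).
by field; rewrite gt_eqF.
Qed.

Lemma is_derive_igamma_slope x : 0 < x ->
  is_derive x 1 igamma_slope
    (igamma_slope x * (m + 1 - alpha * x - igamma_slope x) / x).
Proof.
move=> x0; have F0 := igamma_gt0 x x0.
apply: (is_derive1M (is_derive_xdensity x x0)
  (is_derive1V _ (is_derive_igamma x x0) erefl)); first by rewrite gt_eqF.
by rewrite /igamma_slope; field; rewrite !gt_eqF.
Qed.

(** L'Hopital's rule, using (x F')' = (m + 1 - alpha x) F'. *)
Lemma igamma_slope_cvg0 : igamma_slope x @[x --> 0^'+] --> m + 1.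
Proof.
apply: (@lhopital_at_right _ (fun t => t * gamma_density t)
  (fun x => (m + 1 - alpha * x) * gamma_density x) igamma gamma_density 0 1) => //.
- by move=> x; rewrite in_itv/= => /andP[x0 _]; exact: is_derive_xdensity.
- by move=> x; rewrite in_itv/= => /andP[x0 _]; exact: is_derive_igamma.
- have m1 : 0 < m + 1 by rewrite ltr_wpDl.
  have : x `^ (m + 1) * expR (- alpha * x) @[x --> 0^'+] --> 0 * expR (- alpha * 0).
    apply: cvgM; first exact: powR_cvg0.
    apply: cvg_at_right_filter; apply: continuous_comp; last exact: continuous_expR.
    by apply: cvgM; [exact: cvg_cst|exact: cvg_id].
  rewrite mul0r; apply: cvg_trans; apply: near_eq_cvg; near=> x.
  rewrite /gamma_density powRD; last by apply/implyP => _; rewrite gt_eqF.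
  by rewrite powRr1// [x `^ m * x]mulrC mulrA.
- exact: igamma_cvg0.
- by move=> x; rewrite in_itv/= => /andP[x0 _]; rewrite gt_eqF// gamma_density_gt0.
- have : m + 1 - alpha * x @[x --> 0^'+] --> m + 1 - alpha * 0.
    apply: cvg_at_right_filter; apply: cvgB; first exact: cvg_cst.
    by apply: cvgM; [exact: cvg_cst|exact: cvg_id].
  rewrite mulr0 subr0; apply: cvg_trans; apply: near_eq_cvg; near=> x.
  by rewrite mulfK// gt_eqF// gamma_density_gt0.
Unshelve. all: end_near. Qed.

End IncompleteGamma.

Section SlopeGap.
Context {R : realType}.
Variables (m alpha : R).
Hypothesis m_ge0 : 0 <= m.
Implicit Types (t x : R).

(** Half the derivative of the logarithm of the area mean with respect to ln r,
    at the squared radius x. *)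
Definition slope_gap x := igamma_slope m alpha x - igamma_slope 0 alpha x.

Lemma slope_gap_cvg0 : slope_gap x @[x --> 0^'+] --> m.
Proof.
rewrite -[X in _ --> X](_ : (m + 1) - (0 + 1) = m); last by ring.
by apply: cvgB; exact: igamma_slope_cvg0.
Qed.

(** Since t ^ m <= x ^ m on [0, x], one has F_m (x) <= x ^ m F_0 (x). *)
Lemma slope_gap_ge0 x : 0 < x -> 0 <= slope_gap x.
Proof.
move=> x0.
have F0 := igamma_gt0 m alpha m_ge0 x x0.
have G0 := igamma_gt0 0 alpha (lexx 0) x x0.
rewrite /slope_gap /igamma_slope /gamma_density powRr0 mul1r.
suff : igamma m alpha x <= x `^ m * igamma 0 alpha x.
  move=> FG; rewrite subr_ge0 ler_pdivlMr// mulrAC ler_pdivrMr//.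
  rewrite -!mulrA ler_pM2l// mulrCA ler_pM2l ?expR_gt0//.
rewrite -subr_ge0.
pose f t := x `^ m * igamma 0 alpha t - igamma m alpha t.
apply: (@ge0_of_cvg0_derive_ge0 _ f
    (fun t => (x `^ m - t `^ m) * expR (- alpha * t))) => //.
- move=> t t0 tx.
  have dF := is_derive_igamma m alpha m_ge0 t t0.
  have dG := is_derive_igamma 0 alpha (lexx 0) t t0.
  apply: is_derive_eq.
  by rewrite /gamma_density /GRing.scale/= powRr0; ring.
- move=> t t0 tx; rewrite mulr_ge0 ?expR_ge0// subr_ge0.
  by apply: ge0_ler_powR; rewrite ?nnegrE ?(ltW t0) ?(ltW x0).
- rewrite -[X in _ --> X](_ : x `^ m * 0 - 0 = 0); last by rewrite mulr0 subr0.
  apply: cvgB; last exact: igamma_cvg0.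
  by apply: cvgM; [exact: cvg_cst|exact: igamma_cvg0].
Qed.

Let cvg0_affine_expR : (1 - expR (- alpha * x)) / alpha @[x --> 0^'+] --> 0.
Proof.
rewrite -[X in _ --> X](_ : (1 - expR (- alpha * 0)) / alpha = 0); last first.
  by rewrite mulr0 expR0 subrr mul0r.
apply: cvg_at_right_filter; apply: cvgM; last exact: cvg_cst.
apply: cvgB; first exact: cvg_cst.
apply: continuous_comp; last exact: continuous_expR.
by apply: cvgM; [exact: cvg_cst|exact: cvg_id].
Qed.

Lemma igamma0E x : alpha != 0 -> 0 < x ->
  igamma 0 alpha x = (1 - expR (- alpha * x)) / alpha.
Proof.
move=> a0; apply: (@eq_of_cvg0_derive_eq _ _ (fun t => (1 - expR (- alpha * t)) / alpha)
  (gamma_density 0 alpha)) => //.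
- by move=> t t0; exact: is_derive_igamma.
- move=> t t0; apply: is_derive_eq.
  by rewrite /gamma_density powRr0 /GRing.scale/=; field.
- exact: igamma_cvg0.
Qed.

Lemma igamma_slope0_pos x : 0 < alpha -> 0 < x ->
  igamma_slope 0 alpha x = bern (alpha * x).
Proof.
move=> a0 x0; rewrite /igamma_slope igamma0E ?gt_eqF// /gamma_density powRr0 mul1r.
have e0 := expR_sub1_gt0 (mulr_gt0 a0 x0).
rewrite /bern mulNr expRN; field.
rewrite !gt_eqF ?expR_gt0//.
Qed.

Lemma igamma_slope0_neg x : alpha < 0 -> 0 < x ->
  igamma_slope 0 alpha x = - alpha * x + bern (- alpha * x).
Proof.
move=> a0 x0; rewrite /igamma_slope igamma0E ?lt_eqF// /gamma_density powRr0 mul1r.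
have na0 : 0 < - alpha by rewrite oppr_gt0.
have e0 := expR_sub1_gt0 (mulr_gt0 na0 x0).
rewrite /bern; move: e0; set E := expR _ => e0.
have e1 : E - 1 != 0 by rewrite gt_eqF.
have e2 : 1 - E != 0 by rewrite -opprB oppr_eq0.
by field; rewrite ?e1 ?e2 ?lt_eqF.
Qed.

Lemma is_derive_slope_gap x : 0 < x -> is_derive x 1 slope_gap
  ((igamma_slope m alpha x * (m + 1 - alpha * x - igamma_slope m alpha x)
   - igamma_slope 0 alpha x * (1 - alpha * x - igamma_slope 0 alpha x)) / x).
Proof.
move=> x0.
have dA := is_derive_igamma_slope m alpha m_ge0 x x0.
have dB := is_derive_igamma_slope 0 alpha (lexx 0) x x0.
by apply: is_derive_eq; rewrite add0r mulrBl.
Qed.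

Lemma slope_gap_ode_pos x : 0 < alpha -> 0 < x -> is_derive x 1 slope_gap
  (- ricc m 0 (slope_gap x) (alpha * x) / x).
Proof.
move=> a0 x0; have d := is_derive_slope_gap x x0.
apply: is_derive_eq; congr (_ / _).
rewrite /ricc /slope_gap -(igamma_slope0_pos x a0 x0).
by move: (igamma_slope m alpha x) (igamma_slope 0 alpha x) => A B; ring.
Qed.

Lemma slope_gap_ode_neg x : alpha < 0 -> 0 < x -> is_derive x 1 slope_gap
  (- ricc m m (slope_gap x) (- alpha * x) / x).
Proof.
move=> a0 x0; have d := is_derive_slope_gap x x0.
apply: is_derive_eq; congr (_ / _).
rewrite /ricc; have -> : bern (- alpha * x) = igamma_slope 0 alpha x + alpha * x.
  by rewrite igamma_slope0_neg//; ring.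
rewrite /slope_gap.
by move: (igamma_slope m alpha x) (igamma_slope 0 alpha x) => A B; ring.
Qed.

End SlopeGap.

Section Unweighted.
Context {R : realType}.

Lemma igamma_slope_alpha0 (m x : R) : 0 <= m -> 0 < x -> igamma_slope m 0 x = m + 1.
Proof.
move=> m0 x0; have m1 : 0 < m + 1 by rewrite ltr_wpDl.
have -> : igamma_slope m 0 x = x * gamma_density m 0 x / (x `^ (m + 1) / (m + 1)).
  congr (_ / _).
  apply: (@eq_of_cvg0_derive_eq _ _ (fun t => t `^ (m + 1) / (m + 1))
    (gamma_density m 0)) => //.
  - by move=> t t0; exact: is_derive_igamma.
  - move=> t t0; have dp := is_derive1_powR (m + 1) t0.
    apply: is_derive_eq.
    rewrite /gamma_density /GRing.scale/= oppr0 mul0r expR0 addrK.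
    by field; rewrite gt_eqF.
  - exact: igamma_cvg0.
  - rewrite -[X in _ --> X](mul0r (m + 1)^-1).
    by apply: cvgM; [exact: powR_cvg0|exact: cvg_cst].
rewrite /gamma_density oppr0 mul0r expR0 mulr1.
have xm := powR_gt0 m x0.
rewrite powRD; last by apply/implyP => _; rewrite gt_eqF.
rewrite powRr1 ?ltW//; field.
by rewrite !gt_eqF.
Qed.

End Unweighted.

(** * The area measure in the squared modulus *)

Section Dilation.
Context {R : realType}.
Notation mu := (@lebesgue_measure R).
Local Open Scope ereal_scope.

Lemma measurable_dilation (r : R) :
  measurable_fun setT (( *%R r) : measurableTypeR R -> measurableTypeR R).
Proof. exact: measurable_funM. Qed.

Lemma lebesgue_measure_dilation (r : R) (A : set R) : (0 < r)%R ->
  measurable A -> mu (( *%R r) @^-1` A) = r^-1%:E * mu A.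
Proof.
move=> r0 mA.
pose nu := mscale (NngNum (ltW r0))
  (pushforward mu (( *%R r) : measurableTypeR R -> measurableTypeR R)).
suff -> : mu A = nu (measurable_dilation r) A.
  by rewrite /nu/= /mscale /pushforward/= muleA -EFinM mulVf ?gt_eqF// mul1e.
apply: lebesgue_measure_unique => //=.
move=> _ [[a b] /= _ <-].
have pE : ( *%R r) @^-1` `]a, b] = `](a / r)%R, (b / r)%R]%classic.
  apply/seteqP; split => x /=; rewrite !in_itv/= ltr_pdivrMr// ler_pdivlMr//;
    by rewrite mulrC.
rewrite -[RHS]/(r%:E * mu (( *%R r) @^-1` `]a, b])) pE !lebesgue_measure_itv/=.
rewrite !lte_fin ltr_pM2r ?invr_gt0//.
case: ifP => _; last by rewrite mule0.
by rewrite -EFinD -EFinD -EFinM; congr EFin; field; rewrite gt_eqF.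
Qed.

End Dilation.

Section AreaOfDisks.
Context {R : realType}.
Notation mu := (@lebesgue_measure R).
Local Open Scope ereal_scope.

(** The types carry the Borel sigma-algebras, so that the squared modulus can be
    pushed forward as a measurable map. *)
Definition sqnorm (w : measurableTypeR R * measurableTypeR R) : measurableTypeR R :=
  (w.1 ^+ 2 + w.2 ^+ 2)%R.

Lemma measurable_sqnorm :
  measurable_fun setT sqnorm.
Proof.
by apply: measurable_funD; apply: measurable_funX.
Qed.

Lemma measurable_sqnorm_preimage (A : set (measurableTypeR R)) : measurable A ->
  measurable (sqnorm @^-1` A).
Proof. by move=> mA; rewrite -[X in measurable X]setTI; exact: measurable_sqnorm. Qed.

Definition dilation (r : R) (w : measurableTypeR R * measurableTypeR R) :
  measurableTypeR R * measurableTypeR R := (r * w.1, r * w.2)%R.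

Lemma measurable_dilation2 (r : R) : measurable_fun setT (dilation r).
Proof.
by apply: measurable_fun_pair; exact: measurable_funM.
Qed.

Lemma area_dilation (r : R) (A : set (measurableTypeR R * measurableTypeR R)) :
  (0 < r)%R -> measurable A ->
  @area R (dilation r @^-1` A) = (r^-1 ^+ 2)%:E * @area R A.
Proof.
move=> r0 mA.
have r2 : (0 <= r ^+ 2)%R by rewrite sqr_ge0.
pose nu := mscale (NngNum r2) (pushforward (mu \x mu) (dilation r)).
suff -> : @area R A = nu (measurable_dilation2 r) A.
  by rewrite /nu/= /mscale /pushforward/= muleA -EFinM -exprMn mulVf ?gt_eqF// expr1n mul1e.
apply: product_measure_unique => // B C mB mC.
rewrite -[LHS]/((r ^+ 2)%:E * (mu \x mu) (dilation r @^-1` (B `*` C))).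
have -> : dilation r @^-1` (B `*` C) = (( *%R r) @^-1` B) `*` (( *%R r) @^-1` C) by [].
have mr D : measurable D ->
    measurable ((( *%R r) : measurableTypeR R -> measurableTypeR R) @^-1` D).
  by move=> mD; rewrite -[X in measurable X]setTI; exact: measurable_dilation.
rewrite [X in _ * X]product_measure1E; [|exact: mr..].
rewrite [X in _ * (X * _)]lebesgue_measure_dilation//.
rewrite [X in _ * (_ * X)]lebesgue_measure_dilation//.
have rr : (r ^+ 2)%:E * (r^-1%:E * r^-1%:E) = 1 :> \bar R.
  by rewrite -!EFinM; congr EFin; field; rewrite gt_eqF.
rewrite muleACA [LHS]muleA; transitivity (1 * (mu B * mu C)); last by rewrite mul1e.
by congr (_ * _); exact: rr.
Qed.

Lemma measurable_sqnorm_le (s : R) :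
  measurable ([set w | (sqnorm w <= s)%R] : set (measurableTypeR R * measurableTypeR R)).
Proof.
have -> : [set w | (sqnorm w <= s)%R] = sqnorm @^-1` `]-oo, s].
  by apply/seteqP; split => w /=; rewrite in_itv.
exact: measurable_sqnorm_preimage.
Qed.

Lemma area_sqnorm_le_scale (r : R) : (0 < r)%R ->
  @area R [set w | (sqnorm w <= r ^+ 2)%R] =
  (r ^+ 2)%:E * @area R [set w | (sqnorm w <= 1)%R].
Proof.
move=> r0; have ri : (0 < r^-1)%R by rewrite invr_gt0.
have := area_dilation r^-1 _ ri (measurable_sqnorm_le 1%R).
rewrite invrK => <-; congr (@area R _).
by apply/seteqP; split => w /=;
  rewrite /sqnorm/= !exprMn -mulrDr exprVn ler_pdivrMl ?exprn_gt0// mulr1.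
Qed.


(** An inscribed and a circumscribed square bound the area away from 0 and from
    infinity, so that it can be cancelled in the area mean. *)
Lemma area_unit_disk : exists2 k : R, (0 < k)%R &
  @area R [set w | (sqnorm w <= 1)%R] = k%:E.
Proof.
have mI a b : measurable (`[a, b]%classic : set (measurableTypeR R)) by [].
have squareE a b : (a < b)%R -> @area R (`[a, b] `*` `[a, b]) = ((b - a) ^+ 2)%:E.
  move=> ab; transitivity (mu `[a, b] * mu `[a, b]).
    exact: product_measure1E.
  by rewrite lebesgue_measure_itv/= lte_fin ab -EFinD -EFinM.
have mS a b : measurable (`[a, b] `*` `[a, b] : set (measurableTypeR R * measurableTypeR R)).
  exact: measurableX.
have le4 : @area R [set w | (sqnorm w <= 1)%R] <= 4%:E.
  have -> : 4%:E = @area R (`[(-1)%R, 1%R] `*` `[(-1)%R, 1%R]).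
    by rewrite squareE; [congr EFin; ring|lra].
  apply: le_measure; rewrite ?inE//; first exact: measurable_sqnorm_le.
  move=> [x y] /=; rewrite /sqnorm/= !in_itv/= => xy.
  by split; apply/andP; split; nra.
have ge14 : (4^-1)%:E <= @area R [set w | (sqnorm w <= 1)%R].
  have -> : (4^-1)%:E = @area R (`[0%R, (2^-1)%R] `*` `[0%R, (2^-1)%R]).
    by rewrite squareE; [congr EFin; field|rewrite invr_gt0].
  apply: le_measure; rewrite ?inE//; first exact: measurable_sqnorm_le.
  move=> [x y] /=; rewrite /sqnorm/= !in_itv/= => -[/andP[x0 x1] /andP[y0 y1]].
  nra.
have fk : @area R [set w | (sqnorm w <= 1)%R] \is a fin_num.
  rewrite fin_numElt (lt_le_trans _ ge14) ?ltNyr//=.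
  by rewrite (le_lt_trans le4) ?ltry.
exists (fine (@area R [set w | (sqnorm w <= 1)%R])); last by rewrite fineK.
rewrite -lte_fin fineK//; apply: lt_le_trans ge14.
by rewrite lte_fin invr_gt0.
Qed.

Variable k : R.
Hypothesis k0 : (0 < k)%R.
Hypothesis area_unit : @area R [set w | (sqnorm w <= 1)%R] = k%:E.

Lemma sqnorm_ge0 w : (0 <= sqnorm w)%R.
Proof. by rewrite addr_ge0// sqr_ge0. Qed.

Lemma area_sqnorm_le (s : R) : (0 <= s)%R ->
  @area R [set w | (sqnorm w <= s)%R] = (s * k)%:E.
Proof.
rewrite le_eqVlt => /predU1P[<-|s0]; last first.
  rewrite -(sqr_sqrtr (ltW s0)) area_sqnorm_le_scale ?sqrtr_gt0//.
  by rewrite [X in _ * X]area_unit.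
rewrite mul0r; have -> : [set w | (sqnorm w <= 0)%R] = [set 0%R] `*` [set 0%R].
  apply/seteqP; split => [[x y]|[x y] [/= -> ->]]; rewrite /sqnorm/=; last first.
    by rewrite expr0n addr0.
  have := sqr_ge0 x; have := sqr_ge0 y => y2 x2 xy.
  have /eqP : (x ^+ 2 = 0)%R by lra.
  have /eqP : (y ^+ 2 = 0)%R by lra.
  by rewrite !sqrf_eq0 => /eqP-> /eqP->.
transitivity (mu [set 0%R] * mu [set 0%R]); first exact: product_measure1E.
by rewrite lebesgue_measure_set1 mul0e.
Qed.

Lemma area_sqnorm_le_max (s : R) :
  @area R [set w | (sqnorm w <= s)%R] = (Num.max s 0 * k)%:E.
Proof.
have [s0|s0] := leP 0%R s; first by rewrite area_sqnorm_le// max_l.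
rewrite (_ : [set _ | _] = set0).
  by rewrite /area measure0 mul0r.
apply/seteqP; split => w //=; apply/negP; rewrite -ltNge.
by apply: lt_le_trans (sqnorm_ge0 w).
Qed.

Let positive_half : set (measurableTypeR R) := `[0%R, +oo[%classic.
Let mpositive_half : measurable positive_half. Proof. exact: measurable_itv. Qed.

Lemma area_annulus (a b : R) : (a < b)%R ->
  @area R (sqnorm @^-1` `]a, b]) = ((Num.max b 0 - Num.max a 0) * k)%:E.
Proof.
move=> ab.
have -> : sqnorm @^-1` `]a, b] =
    [set w | (sqnorm w <= b)%R] `\` [set w | (sqnorm w <= a)%R].
  apply/seteqP; split => w /=; rewrite in_itv/=.
    by move=> /andP[aw wb]; split => //; apply/negP; rewrite -ltNge.
  by move=> [wb /negP]; rewrite -ltNge => ->.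
transitivity (@area R [set w | (sqnorm w <= b)%R] - @area R [set w | (sqnorm w <= a)%R]).
  rewrite /area measureD; [|exact: measurable_sqnorm_le..|]; last first.
    by rewrite -[X in X < _]/(@area R _) area_sqnorm_le_max ltry.
  congr (_ - (mu \x mu) _); apply/setIidPr => w /= /le_trans; apply; exact: ltW.
by rewrite !area_sqnorm_le_max -EFinB mulrBl.
Qed.

Lemma lebesgue_measure_itv_half (a b : R) : (a < b)%R ->
  mu (`]a, b] `&` `[0%R, +oo[) = (Num.max b 0 - Num.max a 0)%:E.
Proof.
move=> ab; have [a0|a0] := leP 0%R a.
  have b0 : (0 <= b)%R by rewrite (le_trans a0)// ltW.
  have -> : `]a, b] `&` `[0%R, +oo[ = `]a, b]%classic.
    apply/setIidPl => x /=; rewrite !in_itv/= andbT => /andP[ax _].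
    by rewrite (le_trans a0)// ltW.
  by rewrite lebesgue_measure_itv/= lte_fin ab (max_idPl b0) -EFinB.
have -> : `]a, b] `&` `[0%R, +oo[ = `[0%R, b]%classic.
  apply/seteqP; split => x /=; rewrite !in_itv/= andbT.
    by move=> [/andP[_ ->] ->].
  by move=> /andP[x0 ->]; rewrite (lt_le_trans a0).
rewrite lebesgue_measure_itv/= lte_fin subr0.
have [b0|b0] := ltP 0%R b; rewrite ?sube0//.
Qed.

(** Half-open intervals determine a measure on the line, and the preimage of
    such an interval is an annulus, whose area is k times the length of the
    part of the interval lying in [0, +oo[. *)
Lemma pushforward_sqnorm (A : set (measurableTypeR R)) : measurable A ->
  @area R (sqnorm @^-1` A)
  = k%:E * mu (A `&` `[0%R, +oo[%classic).
Proof.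
move=> mA.
pose m2 : {measure set (measurableTypeR R) -> \bar R} :=
  mscale (NngNum (ltW k0)) (mrestr mu mpositive_half).
pose m1 : {measure set (measurableTypeR R) -> \bar R} :=
  measure_function_pushforward__canonical__measure_function_Measure
  (mu \x mu) measurable_sqnorm.
suff : m1 A = m2 A by [].
apply: (@measure_unique _ R (measurableTypeR R) (@ocitv R)
  (fun n => `](- n%:R)%R, n%:R]%classic : set (measurableTypeR R)) _ _ _ _ m1 m2) => //.
- exact: ocitvI.
- by move=> n; exact: is_ocitv.
- apply/seteqP; split => // x _; exists (Num.truncn `|x|).+1 => //=.
  rewrite in_itv/=; have := truncnS_gt `|x|; rewrite ltr_norml => /andP[h1 h2].
  by rewrite h1 ltW.
- move=> _ [[a b] /= _ <-].
  have [ba|ab] := leP b a.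
    rewrite set_itv_ge; last by rewrite bnd_simp -leNgt.
    by rewrite -[LHS]/(m1 set0) -[RHS]/(m2 set0) !measure0.
  rewrite -[LHS]/(@area R (sqnorm @^-1` `]a, b])).
  rewrite -[RHS]/(k%:E * mu (`]a, b] `&` `[0%R, +oo[)).
  rewrite area_annulus// lebesgue_measure_itv_half// -EFinM.
  by congr EFin; ring.
- move=> n; rewrite -[X in X < _]/(@area R (sqnorm @^-1` `](- n%:R)%R, n%:R%R])).
  have [n0|n0] := leP (n%:R : R) (- n%:R)%R.
    by rewrite set_itv_ge ?preimage_set0 ?bnd_simp -?leNgt// /area measure0.
  by rewrite area_annulus// ltry.
Qed.

Lemma disk_sqnorm (r : R) : (0 < r)%R ->
  disk r = sqnorm @^-1` `[0%R, (r ^+ 2)%R[.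
Proof.
move=> r0; apply/seteqP; split => -[x y] /=;
  rewrite /disk/= /modulus/toC/= in_itv/= sqnorm_ge0/= /sqnorm/=;
  have xy0 : (0 <= x ^+ 2 + y ^+ 2)%R by rewrite addr_ge0// sqr_ge0.
  move=> h; rewrite -(sqr_sqrtr xy0) ltr_pXn2r// ?nnegrE ?sqrtr_ge0 ?(ltW r0)//.
by rewrite -{1}(sqr_sqrtr xy0) ltr_pXn2r// ?nnegrE ?sqrtr_ge0 ?(ltW r0)//.
Qed.

(** Polar coordinates for radial integrands. *)
Lemma integral_disk_radial (h : R -> R) (r : R) : (0 < r)%R ->
  measurable_fun setT h -> (forall t, (0 <= h t)%R) ->
  (\int[@area R]_(w in disk r) (h (sqnorm w)) =
   k * \int[mu]_(t in `[0%R, (r ^+ 2)%R]) h t)%R.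
Proof.
move=> r0 mh h0; rewrite /Rintegral disk_sqnorm//.
have mI : measurable (`[0%R, (r ^+ 2)%R[%classic : set (measurableTypeR R)).
  exact: measurable_itv.
have mhE : measurable_fun (`[0%R, (r ^+ 2)%R[%classic : set (measurableTypeR R))
    (EFin \o h).
  by apply/measurable_EFinP; exact: measurable_funTS.
have -> : \int[@area R]_(w in sqnorm @^-1` `[0%R, (r ^+ 2)%R[) (h (sqnorm w))%:E =
    \int[pushforward (mu \x mu) sqnorm]_(t in `[0%R, (r ^+ 2)%R[) (h t)%:E.
  rewrite ge0_integral_pushforward//; first exact: measurable_sqnorm.
  by move=> t _; rewrite lee_fin.
have -> : \int[pushforward (mu \x mu) sqnorm]_(t in `[0%R, (r ^+ 2)%R[) (h t)%:E =
    \int[mscale (NngNum (ltW k0)) mu]_(t in `[0%R, (r ^+ 2)%R[) (h t)%:E.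
  apply: eq_measure_integral => [|mf A mA AI]; first exact: measurable_sqnorm.
  rewrite -[RHS]/(k%:E * mu A) -[LHS]/(@area R (sqnorm @^-1` A)).
  rewrite pushforward_sqnorm//; congr (_ * mu _); apply/setIidPl.
  by move=> t /AI /=; rewrite !in_itv/= andbT => /andP[].
rewrite ge0_integral_mscale//; last by move=> t _; rewrite lee_fin.
rewrite integral_itv_bndo_bndc//.
by case: (integral _ _ _) => [x| |] //=;
  rewrite ?gt0_muley ?gt0_muleNy ?lte_fin//= mulr0.
Qed.

End AreaOfDisks.

(** * Area means of monomials *)

Section AreaMean.
Context {R : realType}.
Variables (k : nat) (p : R).
Hypothesis p0 : 0 < p.
Implicit Types (alpha r t x y : R).

Let m : R := k%:R * p / 2.

Lemma monomial_exponent_ge0 : 0 <= m.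
Proof. by rewrite /m divr_ge0// mulr_ge0// ltW. Qed.

Lemma modulus_sqr (w : R * R) : modulus (toC w) ^+ 2 = sqnorm w.
Proof.
by case: w => x y; rewrite /modulus /= sqr_sqrtr// addr_ge0// sqr_ge0.
Qed.

Lemma modulusX (z : R[i]) n : modulus (z ^+ n) = modulus z ^+ n.
Proof.
rewrite /modulus; elim: n => [|n IH]; first by rewrite !expr0 Normc.normc1.
by rewrite !exprS Normc.normcM IH.
Qed.

Lemma modulus_ge0 (z : R[i]) : 0 <= modulus z.
Proof. by case: z => x y; exact: sqrtr_ge0. Qed.

(** Since |z ^ k| ^ p = (|z| ^ 2) ^ (k p / 2), both integrands are radial. *)
Lemma area_mean_igamma alpha r : 0 < r ->
  area_mean p alpha (fun z => z ^+ k) r =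
  igamma m alpha (r ^+ 2) / igamma 0 alpha (r ^+ 2).
Proof.
move=> r0; have [c c0 cE] := @area_unit_disk R.
have num w : modulus (toC w ^+ k) `^ p * gauss_weight alpha w =
    gamma_density m alpha (sqnorm w).
  rewrite /gauss_weight modulus_sqr modulusX; congr (_ * _).
  rewrite -modulus_sqr; have := modulus_ge0 (toC w).
  move: (modulus _) => s s0.
  have sX n : s ^+ n = s `^ n%:R by rewrite powR_mulrn.
  by rewrite (sX k) (sX 2) -!powRrM; congr (_ `^ _); rewrite /m; field.
have den w : gauss_weight alpha w = gamma_density 0 alpha (sqnorm w).
  by rewrite /gauss_weight modulus_sqr /gamma_density powRr0 mul1r.
have int n : (\int[@area R]_(w in disk r) gamma_density n alpha (sqnorm w)) =
    c * igamma n alpha (r ^+ 2).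
  apply: integral_disk_radial => //; first exact: measurable_gamma_density.
  by move=> t; rewrite mulr_ge0 ?powR_ge0 ?expR_ge0.
rewrite /area_mean.
under eq_Rintegral do rewrite num.
under [X in _ / X]eq_Rintegral do rewrite den.
by rewrite !int -mulf_div divff ?mul1r// gt_eqF.
Qed.

Lemma is_derive_ln_area_mean alpha t :
  is_derive t 1 (fun s => ln (area_mean p alpha (fun z => z ^+ k) (expR s)))
    (2 * slope_gap m alpha (expR t ^+ 2)).
Proof.
have m0 := monomial_exponent_ge0.
have -> : (fun s => ln (area_mean p alpha (fun z => z ^+ k) (expR s))) =
    (fun s => ln (igamma m alpha (expR s ^+ 2)) - ln (igamma 0 alpha (expR s ^+ 2))).
  apply/funext => s; have s0 : 0 < expR s ^+ 2 by rewrite exprn_gt0// expR_gt0.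
  by rewrite area_mean_igamma ?expR_gt0// ln_div ?posrE ?igamma_gt0.
set x := expR t ^+ 2; have x0 : 0 < x by rewrite exprn_gt0// expR_gt0.
have dln n : 0 <= n ->
    is_derive t 1 (fun s => ln (igamma n alpha (expR s ^+ 2))) (2 * igamma_slope n alpha x).
  move=> n0; have F0 := igamma_gt0 n alpha n0 x x0.
  have dx : is_derive t 1 (fun s => expR s ^+ 2) (2 * x).
    by apply: is_derive_eq; rewrite /GRing.scale/= /x; ring.
  have dF := is_derive_igamma n alpha n0 x x0.
  have dL := is_derive1_ln F0.
  have dFx := @is_derive1_comp _ (igamma n alpha) (fun s => expR s ^+ 2) _ _ _ dF dx.
  have := @is_derive1_comp _ (@ln R) (fun s => igamma n alpha (expR s ^+ 2)) _ _ _ dL dFx.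
  by move/is_derive_eq; apply; rewrite /igamma_slope; field; rewrite gt_eqF.
rewrite /slope_gap mulrBr.
by apply: is_deriveB; exact: dln.
Qed.

End AreaMean.

Section Monotonicity.
Context {R : realType}.
Variables (m alpha : R).
Hypothesis m0 : 0 <= m.

Lemma slope_gap_nonincreasing x y : 0 < alpha -> 0 < x -> x <= y ->
  slope_gap m alpha y <= slope_gap m alpha x.
Proof.
move=> a0; exact: (riccati_nonincreasing m 0 m0 (lexx 0) (slope_gap m alpha) alpha a0
  (fun z => slope_gap_ode_pos m alpha m0 z a0) (slope_gap_ge0 m alpha m0)
  (slope_gap_cvg0 m alpha m0) erefl x y).
Qed.

(** For alpha = 0 the gap is constant, and any point can serve as the summit. *)
Lemma slope_gap_humped : alpha <= 0 -> exists a, [/\ 0 < a,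
  (forall x y, 0 < x -> x <= y -> y <= a -> slope_gap m alpha x <= slope_gap m alpha y) &
  (forall x y, a <= x -> x <= y -> slope_gap m alpha y <= slope_gap m alpha x)].
Proof.
rewrite le_eqVlt => /predU1P[->|a0].
  have gapE x : 0 < x -> slope_gap m 0 x = m.
    by move=> x0; rewrite /slope_gap !igamma_slope_alpha0// add0r addrK.
  exists 1; split => // x y x0 xy.
    by move=> _; rewrite !gapE// (lt_le_trans x0).
  by rewrite !gapE// ?(lt_le_trans _ x0)// (lt_le_trans _ (le_trans x0 xy)).
have na0 : 0 < - alpha by rewrite oppr_gt0.
exact: (riccati_humped m m m0 m0 (slope_gap m alpha) (- alpha) na0
  (fun z => slope_gap_ode_neg m alpha m0 z a0) (slope_gap_ge0 m alpha m0)
  (slope_gap_cvg0 m alpha m0) erefl).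
Qed.

End Monotonicity.

Section LogarithmicVariable.
Context {R : realType}.
Variable I : set R.
Hypothesis I0 : forall r, I r -> 0 < r.

Lemma image_ln_expR t : (@ln R @` I) t -> I (expR t).
Proof. by move=> [r Ir <-]; rewrite lnK// posrE I0. Qed.

Lemma is_interval_image_ln : is_interval I -> is_interval (@ln R @` I).
Proof.
move=> iI _ _ [r Ir <-] [s Is <-] t /andP[rt ts]; exists (expR t); last exact: expRK.
apply: (iI r s) => //; apply/andP; split.
  by rewrite -(lnK (I0 _ Ir)) ler_expR.
by rewrite -(lnK (I0 _ Is)) ler_expR.
Qed.

End LogarithmicVariable.

Theorem theorem7 (R : realType) (k : nat) (p : R) (hp : 0 < p) :
  (forall alpha : R, 0 < alpha ->
     concave_in_ln `]0, +oo[
       (fun r : R => ln (area_mean p alpha (fun z : R[i] => z ^+ k) r))) /\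
  (forall alpha : R, alpha <= 0 ->
     exists c : R, 0 < c /\
       convex_in_ln `]0, c]
         (fun r : R => ln (area_mean p alpha (fun z : R[i] => z ^+ k) r)) /\
       concave_in_ln `[c, +oo[
         (fun r : R => ln (area_mean p alpha (fun z : R[i] => z ^+ k) r))).
Proof.
pose m : R := k%:R * p / 2.
have m0 : 0 <= m by exact: monomial_exponent_ge0.
have two_gt0 : 0 < 2 :> R by [].
have convex alpha (I : set R) : (forall r, I r -> 0 < r) -> is_interval I ->
    (forall r s, I r -> I s -> r <= s ->
      slope_gap m alpha (r ^+ 2) <= slope_gap m alpha (s ^+ 2)) ->
    convex_in_ln I (fun r => ln (area_mean p alpha (fun z : R[i] => z ^+ k) r)).
  move=> I0 iI mono; apply: (convex_function_derive_nondecreasing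
    _ (fun t => 2 * slope_gap m alpha (expR t ^+ 2))).
  - exact: is_interval_image_ln.
  - by move=> t _; exact: is_derive_ln_area_mean.
  - move=> s t Is It st; rewrite (ler_pM2l two_gt0).
    by apply: mono; rewrite ?ler_expR//; exact: image_ln_expR.
have concave alpha (I : set R) : (forall r, I r -> 0 < r) -> is_interval I ->
    (forall r s, I r -> I s -> r <= s ->
      slope_gap m alpha (s ^+ 2) <= slope_gap m alpha (r ^+ 2)) ->
    concave_in_ln I (fun r => ln (area_mean p alpha (fun z : R[i] => z ^+ k) r)).
  move=> I0 iI mono; apply: (convex_function_derive_nondecreasing
    _ (fun t => - (2 * slope_gap m alpha (expR t ^+ 2)))).
  - exact: is_interval_image_ln.
  - by move=> t _; apply: is_deriveN; exact: is_derive_ln_area_mean.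
  - move=> s t Is It st; rewrite lerN2 (ler_pM2l two_gt0).
    by apply: mono; rewrite ?ler_expR//; exact: image_ln_expR.
have sqr_le r s : 0 < r -> r <= s -> r ^+ 2 <= s ^+ 2 :> R.
  by move=> r0 rs; rewrite ler_pXn2r ?nnegrE// ltW// (lt_le_trans r0).
split=> alpha a0.
  apply: concave; [|exact: interval_is_interval|].
    by move=> r /=; rewrite in_itv/= andbT.
  move=> r s /=; rewrite !in_itv/= !andbT => r0 s0 rs.
  by apply: slope_gap_nonincreasing => //; [rewrite exprn_gt0|exact: sqr_le].
have [a [a_gt0 inc dec]] := slope_gap_humped m alpha m0 a0.
exists (Num.sqrt a); have c0 : 0 < Num.sqrt a by rewrite sqrtr_gt0.
have aE : a = Num.sqrt a ^+ 2 by rewrite sqr_sqrtr// ltW.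
split => //; split.
  apply: convex; [|exact: interval_is_interval|].
    by move=> r /=; rewrite in_itv/= => /andP[].
  move=> r s /=; rewrite !in_itv/= => /andP[r0 _] /andP[s0 sc] rs.
  by apply: inc; [rewrite exprn_gt0|exact: sqr_le|rewrite [leRHS]aE sqr_le].
apply: concave; [|exact: interval_is_interval|].
  by move=> r /=; rewrite in_itv/= andbT; exact: lt_le_trans.
move=> r s /=; rewrite !in_itv/= !andbT => rc _ rs.
by apply: dec; [rewrite [leLHS]aE sqr_le|apply: sqr_le => //; exact: lt_le_trans rc].
Qed.
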